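(* Let $\mu_1,\mu_2,\mu_3$ be nonzero real numbers. If a relative equilibrium of the $(1+3)$-vortex problem with circulation weights $\mu_1,\mu_2,\mu_3$ is symmetric, then two of the infinitesimal vortices have equal weight, i.e. $\mu_i=\mu_j$ for some $i\ne j$ in $\{1,2,3\}$.
   Context: Write $(x,y)^\perp=(-y,x)$. A relative equilibrium configuration of the $4$-vortex problem with nonzero circulations $\Gamma_0,\dots,\Gamma_3$ and rotation rate $\omega$ is a tuple of distinct points $q_0,\dots,q_3\in\mathbb{R}^2$, with center of vorticity at the origin ($\sum_{i=0}^3\Gamma_iq_i=0$), such that $$\omega\,\Gamma_i q_i^\perp+\sum_{j\ne i}\frac{\Gamma_i\Gamma_j (q_j-q_i)^\perp}{|q_i-q_j|^2}=0,\qquad i=0,\dots,3.$$ Throughout, the rotation rate is fixed to be $\omega=1$. A relative equilibrium of the $(1+3)$-vortex problem with weights $\mu_1,\mu_2,\mu_3$ is a configuration $\bar q_0,\dots,\bar q_3$ for which there exist a sequence of nonzero reals $\varepsilon_k\to0$ and relative equilibrium configurations $q_0^k,\dots,q_3^k$ of the $4$-vortex problem with circulations $\Gamma_0^k=1$, $\Gamma_i^k=\varepsilon_k\mu_i$ ($i=1,2,3$), such that $q_j^k\to\bar q_j$ as $k\to\infty$ for every $j$. It is assumed throughout that vortices do not collide in the limit: there is $m>0$, independent of $k$, with $|q_i^k-q_j^k|>m$ for all $i\neq j$ and all $k$. The vortex $\bar q_0$ is the strong vortex and $\bar q_1,\bar q_2,\bar q_3$ are the infinitesimal vortices, with weights $\mu_1,\mu_2,\mu_3$.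 Such a configuration is symmetric if a line can be drawn through the strong vortex and one infinitesimal vortex such that the other two infinitesimal vortices are symmetrically located with respect to this line (they are mirror images of each other in the line). *)

(* Defs.v *)
From HB Require Import structures.
From mathcomp Require Import all_boot all_order all_algebra.
From mathcomp Require Import all_classical all_reals all_analysis.

Set Implicit Arguments.
Unset Strict Implicit.
Unset Printing Implicit Defensive.

Import Order.TTheory GRing.Theory Num.Theory.
Import numFieldNormedType.Exports.

Local Open Scope classical_set_scope.
Local Open Scope ring_scope.

(* The norm `|q| that MathComp-Analysis puts on 'rV[R]_2 is the sup norm, so the
   Euclidean structure of the plane is given explicitly. The convergence of
   sequences in 'rV[R]_2 is the same for both norms. *)
Definition dotp (R : realType) (u v : 'rV[R]_2) : R := (u *m v^T) 0 0.

Definition enorm (R : realType) (u : 'rV[R]_2) : R := Num.sqrt (dotp u u).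

Definition perp (R : realType) (u : 'rV[R]_2) : 'rV[R]_2 :=
  \row_(c < 2) (if c == 0 then - u 0 1 else u 0 0).

Definition rel_equilibrium (R : realType) (n : nat) (omega : R)
    (Gamma : 'I_n -> R) (q : 'I_n -> 'rV[R]_2) : Prop :=
  [/\ forall i, Gamma i != 0,
      injective q,
      \sum_(i < n) Gamma i *: q i = 0
    & forall i, (omega * Gamma i) *: perp (q i)
        + \sum_(j < n | j != i)
            (Gamma i * Gamma j / enorm (q i - q j) ^+ 2) *: perp (q j - q i)
        = 0].

(* Index ord0 is the strong vortex; lift ord0 i is the infinitesimal vortex of
   weight mu i. *)
Definition circulation (R : realType) (n : nat) (eps : R) (mu : 'I_n -> R)
    (j : 'I_n.+1) : R :=
  if unlift ord0 j is Some i then eps * mu i else 1.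

(* The rotation rate is fixed to be 1, and noncollision in the limit is part of
   the definition. *)
Definition rel_equilibrium_1n (R : realType) (n : nat) (mu : 'I_n -> R)
    (qbar : 'I_n.+1 -> 'rV[R]_2) : Prop :=
  exists (eps : nat -> R) (q : nat -> 'I_n.+1 -> 'rV[R]_2),
    [/\ forall k, eps k != 0,
        eps k @[k --> \oo] --> (0 : R),
        forall k, rel_equilibrium 1 (circulation (eps k) mu) (q k),
        forall j, q k j @[k --> \oo] --> qbar j
      & exists2 m : R, 0 < m &
          forall k i j, i != j -> m < enorm (q k i - q k j)].

Definition line (R : realType) (p d : 'rV[R]_2) : set 'rV[R]_2 :=
  [set x | exists t : R, x = p + t *: d].

(* Reflection in line p d, for d != 0. *)
Definition mirror (R : realType) (p d x : 'rV[R]_2) : 'rV[R]_2 :=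
  p + (2 * (dotp (x - p) d / dotp d d)) *: d - (x - p).

Definition symmetric_configuration (R : realType) (q : 'I_4 -> 'rV[R]_2) : Prop :=
  exists (p d : 'rV[R]_2) (i j k : 'I_3),
    [/\ d != 0,
        uniq [:: i; j; k],
        line p d (q ord0),
        line p d (q (lift ord0 i))
      & q (lift ord0 k) = mirror p d (q (lift ord0 j))].

(* Main.v *)
Require Import Defs.
From HB Require Import structures.
From mathcomp Require Import all_boot all_order all_algebra.
From mathcomp Require Import all_classical all_reals all_analysis.
From mathcomp Require Import ring lra.

Set Implicit Arguments.
Unset Strict Implicit.
Unset Printing Implicit Defensive.

Import Order.TTheory GRing.Theory Num.Theory.
Import numFieldNormedType.Exports.

Local Open Scope ring_scope.

(** Call [dotp u (perp v)] the torque pairing of [u] and [v]: it is the oriented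
area of the parallelogram that they span, up to sign.  Pairing the [i]-th
equation of motion with [q i] kills the rotation term and leaves a balance of
torques.  The strong vortex has no circulation of order [eps], but the center
of vorticity places it at [q ord0 = - eps * \sum_j mu j *: q j], so that its
torque is of order [eps] as well; after division by [eps] one obtains, exactly
and for every nonzero [eps] ([torque_balance]),
   [\sum_(j != i) mu j * (1 / r_ij ^ 2 - 1 / r_i0 ^ 2) * dotp q_i (perp q_j) = 0].
In the limit the strong vortex sits at the origin ([limit_strong_vortex]) and
the infinitesimal ones on the unit circle around it ([limit_unit_circle]), so
[r_i0 = 1] there: with polar angles [theta_i] the limit condition
([limit_torque_balance]) is [\sum_(j != i) mu j * f (theta_j - theta_i) = 0] where
[f t = sin t * (1 / (2 - 2 * cos t) - 1)].

In a symmetric configuration the angles can be taken to be [0], [t] and [- t].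
As [f] is odd, the condition at the vortex on the axis is
[(mu j - mu k) * f t = 0].  The mirror images are distinct, so [sin t] is not
zero, and unequal weights force [cos t = 1 / 2].  But then the vortex on the axis
is at distance [1] from its neighbours and exerts no torque on them, while the
two mirror images, at angle [2 pi / 3], do exert one on each other: the
condition at vortex [j] becomes [mu k * f (2 pi / 3) = 0], contradicting
[mu k != 0]. *)

(** * The Euclidean plane in coordinates *)

Lemma dotpE (R : realType) (u v : 'rV[R]_2) :
  dotp u v = u 0 0 * v 0 0 + u 0 1 * v 0 1.
Proof.
rewrite /dotp mxE big_ord_recl big_ord1 !mxE.
by have -> : lift ord0 ord0 = 1 :> 'I_2 by apply/val_inj.
Qed.

Lemma dotp_perpE (R : realType) (u v : 'rV[R]_2) :
  dotp u (perp v) = u 0 1 * v 0 0 - u 0 0 * v 0 1.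
Proof. by rewrite dotpE !mxE /=; ring. Qed.

Lemma dotp_perp_self (R : realType) (u : 'rV[R]_2) : dotp u (perp u) = 0.
Proof. by rewrite dotp_perpE; ring. Qed.

Lemma enorm_sqr (R : realType) (u : 'rV[R]_2) : enorm u ^+ 2 = dotp u u.
Proof. by rewrite sqr_sqrtr // dotpE addr_ge0 // -expr2 sqr_ge0. Qed.

Lemma dotp0r (R : realType) (u : 'rV[R]_2) : dotp u 0 = 0.
Proof. by rewrite dotpE !mxE; ring. Qed.

Lemma dotpDr (R : realType) (u v w : 'rV[R]_2) :
  dotp u (v + w) = dotp u v + dotp u w.
Proof. by rewrite !dotpE !mxE; ring. Qed.

Lemma dotpZr (R : realType) (u v : 'rV[R]_2) (a : R) :
  dotp u (a *: v) = a * dotp u v.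
Proof. by rewrite !dotpE !mxE; ring. Qed.

Lemma dotp_sumr (R : realType) (I : Type) (r : seq I) (P : pred I)
    (u : 'rV[R]_2) (v : I -> 'rV[R]_2) :
  dotp u (\sum_(i <- r | P i) v i) = \sum_(i <- r | P i) dotp u (v i).
Proof. exact: (big_morph (dotp u) (dotpDr u) (dotp0r u)). Qed.

Lemma perpD (R : realType) (u v : 'rV[R]_2) : perp (u + v) = perp u + perp v.
Proof. by apply/rowP => c; rewrite !mxE; case: ifP => _ //; ring. Qed.

Lemma perpZ (R : realType) (a : R) (u : 'rV[R]_2) : perp (a *: u) = a *: perp u.
Proof. by apply/rowP => c; rewrite !mxE; case: ifP => _ //; ring. Qed.

Lemma perp_sum (R : realType) (I : Type) (r : seq I) (P : pred I)
    (v : I -> 'rV[R]_2) :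
  perp (\sum_(i <- r | P i) v i) = \sum_(i <- r | P i) perp (v i).
Proof.
apply: (big_morph (@perp R)) => [u w|]; first exact: perpD.
by rewrite -[0 in LHS](scale0r 0) perpZ scale0r.
Qed.

(** * Consequences of the equations of motion *)

Lemma rel_equilibrium_dotp (R : realType) (n : nat) (omega : R)
    (Gamma : 'I_n -> R) (q : 'I_n -> 'rV[R]_2) (u : 'rV[R]_2) (i : 'I_n) :
  rel_equilibrium omega Gamma q ->
  omega * dotp u (perp (q i))
  + \sum_(j < n | j != i)
      Gamma j / enorm (q i - q j) ^+ 2 * dotp u (perp (q j - q i)) = 0.
Proof.
case=> Gamma0 _ _ /(_ i) /(congr1 (dotp u)); rewrite dotp0r dotpDr dotpZr.
rewrite dotp_sumr -mulrA => eq_i; apply: (mulfI (Gamma0 i)).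
rewrite mulr0 -[RHS]eq_i mulrDr; congr (_ + _); first by ring.
by rewrite mulr_sumr; apply: eq_bigr => j _; rewrite dotpZr -!mulrA.
Qed.

Lemma torque_balance_vortices (R : realType) (n : nat) (omega : R)
    (Gamma : 'I_n -> R) (q : 'I_n -> 'rV[R]_2) (i : 'I_n) :
  rel_equilibrium omega Gamma q ->
  \sum_(j < n | j != i)
    Gamma j / enorm (q i - q j) ^+ 2 * dotp (q i) (perp (q j)) = 0.
Proof.
move=> /(rel_equilibrium_dotp (q i) i).
rewrite dotp_perp_self mulr0 add0r => bal.
rewrite -[RHS]bal; apply: eq_bigr => j _; congr (_ * _); rewrite !dotp_perpE !mxE; ring.
Qed.

Lemma radial_balance_vortices (R : realType) (n : nat) (omega : R)
    (Gamma : 'I_n -> R) (q : 'I_n -> 'rV[R]_2) (i : 'I_n) :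
  rel_equilibrium omega Gamma q ->
  omega * enorm (q i) ^+ 2 =
  \sum_(j < n | j != i)
    Gamma j / enorm (q i - q j) ^+ 2 * dotp (q i) (q i - q j).
Proof.
move=> /(rel_equilibrium_dotp (perp (q i)) i) /eqP; rewrite addr_eq0 => /eqP.
have -> : dotp (perp (q i)) (perp (q i)) = enorm (q i) ^+ 2.
  by rewrite enorm_sqr !dotpE !mxE /=; ring.
move=> ->; rewrite -sumrN; apply: eq_bigr => j _; rewrite -mulrN.
by congr (_ * _); rewrite !dotpE !mxE /=; ring.
Qed.

Lemma circulation0 (R : realType) (n : nat) (eps : R) (mu : 'I_n -> R) :
  circulation eps mu ord0 = 1.
Proof. by rewrite /circulation unlift_none. Qed.

Lemma circulation_lift (R : realType) (n : nat) (eps : R) (mu : 'I_n -> R)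
    (i : 'I_n) :
  circulation eps mu (lift ord0 i) = eps * mu i.
Proof. by rewrite /circulation liftK. Qed.

Lemma big_ord_recl_neq_lift (V : nmodType) (n : nat) (i : 'I_n)
    (F : 'I_n.+1 -> V) :
  \sum_(j < n.+1 | j != lift ord0 i) F j =
  F ord0 + \sum_(j < n | j != i) F (lift ord0 j).
Proof.
rewrite big_mkcond big_ord_recl /=; congr (_ + _).
by rewrite -big_mkcond.
Qed.

Lemma strong_vortex (R : realType) (n : nat) (omega eps : R) (mu : 'I_n -> R)
    (q : 'I_n.+1 -> 'rV[R]_2) :
  rel_equilibrium omega (circulation eps mu) q ->
  q ord0 = - eps *: \sum_(j < n) mu j *: q (lift ord0 j).
Proof.
case=> _ _ + _; rewrite big_ord_recl circulation0 scale1r => /eqP.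
rewrite addr_eq0 => /eqP ->; rewrite scaleNr scaler_sumr; congr (- _).
by apply: eq_bigr => j _; rewrite circulation_lift scalerA.
Qed.

(** The torque of the strong vortex, expressed through the infinitesimal ones by
the center of vorticity, carries the same factor [eps] as theirs. *)
Lemma torque_balance (R : realType) (n : nat) (omega eps : R) (mu : 'I_n -> R)
    (q : 'I_n.+1 -> 'rV[R]_2) (i : 'I_n) :
  eps != 0 -> rel_equilibrium omega (circulation eps mu) q ->
  let qi := q (lift ord0 i) in
  \sum_(j < n | j != i)
    mu j * ((enorm (qi - q (lift ord0 j)) ^+ 2)^-1
            - (enorm (qi - q ord0) ^+ 2)^-1)
    * dotp qi (perp (q (lift ord0 j))) = 0.
Proof.
move=> eps0 eqm qi; have := torque_balance_vortices (lift ord0 i) eqm.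
rewrite big_ord_recl_neq_lift circulation0 -/qi.
have -> : dotp qi (perp (q ord0)) =
    - eps * \sum_(j < n | j != i) mu j * dotp qi (perp (q (lift ord0 j))).
  rewrite (strong_vortex eqm) perpZ dotpZr perp_sum dotp_sumr.
  congr (_ * _); rewrite (bigD1 i) //= perpZ dotpZr -/qi.
  by rewrite dotp_perp_self mulr0 add0r; apply: eq_bigr => j _; rewrite perpZ dotpZr.
move=> bal; apply: (mulfI eps0); rewrite mulr0 -[RHS]bal mulrA !mulr_sumr -big_split.
by apply: eq_bigr => j _; rewrite /= circulation_lift; ring.
Qed.

(** * Passage to the limit *)

Section Limits.
Local Open Scope classical_set_scope.
Variable R : realType.
Implicit Types (u v : nat -> 'rV[R]_2) (a b : 'rV[R]_2).

Lemma limit_unique (f : nat -> R) (l l' : R) :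
  f k @[k --> \oo] --> l -> f k @[k --> \oo] --> l' -> l = l'.
Proof. by move=> fl fl'; exact: (@cvg_unique _ (@Rhausdorff R) _ _ _ _ fl fl'). Qed.

Lemma cvg_entry u a c : u k @[k --> \oo] --> a -> u k 0 c @[k --> \oo] --> a 0 c.
Proof.
by move=> ua; exact: (cvg_comp _ _ ua (@coord_continuous R 1 2 0 c a)).
Qed.

Lemma cvg_dotp u v a b : u k @[k --> \oo] --> a -> v k @[k --> \oo] --> b ->
  dotp (u k) (v k) @[k --> \oo] --> dotp a b.
Proof.
move=> ua vb; rewrite dotpE; under eq_fun do rewrite dotpE.
by apply: cvgD; apply: cvgM; exact: cvg_entry.
Qed.

Lemma cvg_dotp_perp u v a b :
  u k @[k --> \oo] --> a -> v k @[k --> \oo] --> b ->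
  dotp (u k) (perp (v k)) @[k --> \oo] --> dotp a (perp b).
Proof.
move=> ua vb; rewrite dotp_perpE; under eq_fun do rewrite dotp_perpE.
by apply: cvgB; apply: cvgM; exact: cvg_entry.
Qed.

Lemma cvg_enorm_sqr u a : u k @[k --> \oo] --> a ->
  enorm (u k) ^+ 2 @[k --> \oo] --> enorm a ^+ 2.
Proof.
move=> ua; rewrite enorm_sqr; under eq_fun do rewrite enorm_sqr.
exact: cvg_dotp.
Qed.

Lemma cvg_sumr (n : nat) (P : pred 'I_n) (f : 'I_n -> nat -> R) (l : 'I_n -> R) :
  (forall j, P j -> f j k @[k --> \oo] --> l j) ->
  \sum_(j < n | P j) f j k @[k --> \oo] --> \sum_(j < n | P j) l j.
Proof. by move=> fl; apply: cvg_big => //; exact: add_continuous. Qed.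

Lemma cvg_mul_vanishing (e f : nat -> R) (l : R) :
  e k @[k --> \oo] --> 0 -> f k @[k --> \oo] --> l ->
  e k * f k @[k --> \oo] --> 0.
Proof. by move=> e0 fl; rewrite -(mul0r l); exact: cvgM. Qed.

Lemma limit_noncollision (n : nat) (mu : 'I_n -> R)
    (qbar : 'I_n.+1 -> 'rV[R]_2) (i j : 'I_n.+1) :
  rel_equilibrium_1n mu qbar -> i != j -> enorm (qbar i - qbar j) ^+ 2 != 0.
Proof.
move=> [eps [q [_ _ _ qq [m m0 qm]]]] ij.
have cij : enorm (q k i - q k j) ^+ 2 @[k --> \oo] --> enorm (qbar i - qbar j) ^+ 2.
  by apply: cvg_enorm_sqr; exact: cvgB.
suff : m ^+ 2 <= enorm (qbar i - qbar j) ^+ 2.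
  by move=> le_m; rewrite gt_eqF // (lt_le_trans _ le_m) // exprn_gt0.
apply: (cvgr_to_ge cij); apply: nearW => k.
by rewrite lerXn2r ?nnegrE ?sqrtr_ge0 ?(ltW m0) ?(ltW (qm _ _ _ ij)).
Qed.

Lemma limit_strong_vortex (n : nat) (mu : 'I_n -> R)
    (qbar : 'I_n.+1 -> 'rV[R]_2) :
  rel_equilibrium_1n mu qbar -> qbar ord0 = 0.
Proof.
move=> [eps [q [_ eps0 eqm qq _]]]; apply/rowP => c; rewrite mxE.
apply: (limit_unique (cvg_entry (c := c) (qq ord0))) => /=.
have -> : (fun k => q k ord0 0 c) =
    (fun k => - eps k * \sum_(j < n) mu j * q k (lift ord0 j) 0 c).
  apply/funext => k; rewrite (strong_vortex (eqm k)) !mxE summxE.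
  by congr (_ * _); apply: eq_bigr => j _; rewrite mxE.
apply: (cvg_mul_vanishing (l := \sum_(j < n) mu j * qbar (lift ord0 j) 0 c)).
  by rewrite -[X in _ --> X]oppr0; exact: cvgN.
by apply: cvg_sumr => j _; apply: cvgM; [exact: cvg_cst | exact: cvg_entry].
Qed.

(** The radial force of the infinitesimal vortices disappears in the limit, and
the rotation alone balances that of the strong vortex: [r = 1 / r]. *)
Lemma limit_unit_circle (n : nat) (mu : 'I_n -> R)
    (qbar : 'I_n.+1 -> 'rV[R]_2) (i : 'I_n) :
  rel_equilibrium_1n mu qbar -> enorm (qbar (lift ord0 i)) ^+ 2 = 1.
Proof.
move=> lim; have q0 := limit_strong_vortex lim.
have noncol j j' := @limit_noncollision _ _ _ j j' lim.
have := noncol (lift ord0 i) ord0 isT; rewrite q0 subr0 => qi0.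
case: lim => [eps [q [_ eps0 eqm qq _]]].
pose r2 k j := enorm (q k (lift ord0 i) - q k j) ^+ 2.
pose d k j := dotp (q k (lift ord0 i)) (q k (lift ord0 i) - q k j).
have cvg_term j : j != lift ord0 i ->
    (r2 k j)^-1 * d k j @[k --> \oo] -->
    (enorm (qbar (lift ord0 i) - qbar j) ^+ 2)^-1
      * dotp (qbar (lift ord0 i)) (qbar (lift ord0 i) - qbar j).
  move=> ji; apply: cvgM.
    apply: cvgV; first by apply: noncol; rewrite eq_sym.
    by apply: cvg_enorm_sqr; exact: cvgB.
  by apply: cvg_dotp => //; apply: cvgB.
apply: (limit_unique (cvg_enorm_sqr (qq (lift ord0 i)))) => /=.
have -> : (fun k => enorm (q k (lift ord0 i)) ^+ 2) =
    (fun k => (r2 k ord0)^-1 * d k ord0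
      + eps k * \sum_(j < n | j != i)
          mu j * ((r2 k (lift ord0 j))^-1 * d k (lift ord0 j))).
  apply/funext => k; rewrite -[LHS]mul1r.
  rewrite (radial_balance_vortices (lift ord0 i) (eqm k)).
  rewrite big_ord_recl_neq_lift circulation0 div1r; congr (_ + _).
  by rewrite mulr_sumr; apply: eq_bigr => j _; rewrite circulation_lift !mulrA.
have {1}<- : (enorm (qbar (lift ord0 i) - qbar ord0) ^+ 2)^-1
    * dotp (qbar (lift ord0 i)) (qbar (lift ord0 i) - qbar ord0) = 1.
  by rewrite q0 subr0 -enorm_sqr mulVf.
rewrite -[X in _ --> X]addr0; apply: cvgD; first exact: cvg_term.
apply: (cvg_mul_vanishing (l := \sum_(j < n | j != i)
  mu j * ((enorm (qbar (lift ord0 i) - qbar (lift ord0 j)) ^+ 2)^-1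
    * dotp (qbar (lift ord0 i)) (qbar (lift ord0 i) - qbar (lift ord0 j))))) => //.
apply: cvg_sumr => j ji; apply: cvgM; first exact: cvg_cst.
by apply: cvg_term; rewrite (inj_eq (@lift_inj _ _)).
Qed.

Lemma limit_torque_balance (n : nat) (mu : 'I_n -> R)
    (qbar : 'I_n.+1 -> 'rV[R]_2) (i : 'I_n) :
  rel_equilibrium_1n mu qbar ->
  let qi := qbar (lift ord0 i) in
  \sum_(j < n | j != i)
    mu j * ((enorm (qi - qbar (lift ord0 j)) ^+ 2)^-1 - 1)
    * dotp qi (perp (qbar (lift ord0 j))) = 0.
Proof.
move=> lim qi; have noncol j j' := @limit_noncollision _ _ _ j j' lim.
have r0 : 1 = (enorm (qi - qbar ord0) ^+ 2)^-1.
  by rewrite (limit_strong_vortex lim) subr0 (limit_unit_circle i lim) invr1.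
rewrite r0; case: lim => [eps [q [eps_neq0 eps0 eqm qq _]]].
apply: (@limit_unique (fun=> 0)); last exact: cvg_cst.
have /= bal k := torque_balance i (eps_neq0 k) (eqm k).
rewrite -(funext bal).
apply: cvg_sumr => j ji; apply: cvgM; last exact: cvg_dotp_perp.
apply: cvgM; first exact: cvg_cst.
apply: cvgB; (apply: cvgV; last by apply: cvg_enorm_sqr; exact: cvgB).
  by apply: noncol; rewrite (inj_eq (@lift_inj _ _)) eq_sym.
exact: noncol.
Qed.

End Limits.

(** * Symmetric configurations of three vortices on the circle *)

(** A line through the origin and the unit vector [a] has direction [a], up to a
scalar on which the reflection does not depend. *)
Lemma mirror_through_origin (R : realType) (p d a b : 'rV[R]_2) :
  line p d 0 -> line p d a -> enorm a ^+ 2 = 1 ->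
  mirror p d b = (2 * dotp a b) *: a - b.
Proof.
move=> [t /eqP]; rewrite eq_sym addr_eq0 => /eqP -> [s ->].
rewrite -scaleNr -scalerDl; set l := - t + s; rewrite enorm_sqr => ad1.
have dd : dotp d d = (l ^+ 2)^-1.
  move: ad1; rewrite !dotpE !mxE => ad1.
  have l0 : l ^+ 2 != 0.
    by apply/eqP => l0; move: ad1 (oner_neq0 R); nra.
  apply: (mulfI l0); rewrite mulfV // -ad1; ring.
have l0 : l != 0.
  apply/eqP => l0; move: ad1; rewrite l0 scale0r dotp0r; apply/eqP.
  by rewrite eq_sym oner_neq0.
have bd : dotp (b - - t *: d) d = dotp d b + t * dotp d d.
  by rewrite !dotpE !mxE; ring.
have ab : dotp (l *: d) b = l * dotp d b by rewrite !dotpE !mxE; ring.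
by rewrite /mirror bd ab dd; apply/rowP => c; rewrite !mxE; field.
Qed.

Lemma sum_ord3_neq (V : nmodType) (i j k : 'I_3) (F : 'I_3 -> V) :
  uniq [:: i; j; k] -> \sum_(l < 3 | l != i) F l = F j + F k.
Proof.
rewrite /= !inE !negb_or andbT => /andP[/andP[ij ik] jk].
rewrite (bigD1 j) 1?eq_sym //= (bigD1 k) /=; last by rewrite ![k == _]eq_sym ik.
rewrite big_pred0 ?addr0 // => l; apply/negbTE; move: ij ik jk.
by move: i j k l; do 4 case=> [[|[|[|?]]] ?] //=.
Qed.

(** If the weights [m2] and [m3] differ, the balance at [a] puts [b] and [c] at
distance [1] from [a], so that [dotp a b = 1 / 2] and the distance between [b] and
[c] is [sqrt 3].  At [b] only the torque of [c] remains then, and it is nonzero. *)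
Lemma symmetric_balance_weights (R : realType) (m1 m2 m3 : R)
    (a b c : 'rV[R]_2) :
  enorm a ^+ 2 = 1 -> enorm b ^+ 2 = 1 -> c = (2 * dotp a b) *: a - b ->
  enorm (a - b) ^+ 2 != 0 -> enorm (b - c) ^+ 2 != 0 ->
  m2 * ((enorm (a - b) ^+ 2)^-1 - 1) * dotp a (perp b)
  + m3 * ((enorm (a - c) ^+ 2)^-1 - 1) * dotp a (perp c) = 0 ->
  m1 * ((enorm (b - a) ^+ 2)^-1 - 1) * dotp b (perp a)
  + m3 * ((enorm (b - c) ^+ 2)^-1 - 1) * dotp b (perp c) = 0 ->
  m3 != 0 -> m2 = m3.
Proof.
rewrite !enorm_sqr => ui uj c_eq rij rjk bal_i bal_j m3_neq0.
pose x := dotp a b; pose s := dotp a (perp b).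
have s2 : s ^+ 2 = 1 - x ^+ 2.
  have : s ^+ 2 + x ^+ 2 = dotp a a * dotp b b.
    by rewrite /s /x dotp_perpE !dotpE; ring.
  by rewrite ui uj; lra.
have dab : dotp (a - b) (a - b) = 2 - 2 * x.
  have -> : dotp (a - b) (a - b) = dotp a a + dotp b b - 2 * x.
    by rewrite /x !dotpE !mxE; ring.
  by rewrite ui uj; lra.
have dba : dotp (b - a) (b - a) = 2 - 2 * x.
  by rewrite -dab !dotpE !mxE; ring.
have dac : dotp (a - c) (a - c) = 2 - 2 * x.
  have -> : dotp (a - c) (a - c) =
      (1 - 4 * x + 4 * x ^+ 2) * dotp a a + dotp b b + (2 - 4 * x) * x.
    by rewrite c_eq /x !dotpE !mxE; ring.
  by rewrite ui uj; ring.
have dbc : dotp (b - c) (b - c) = 4 - 4 * x ^+ 2.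
  have -> : dotp (b - c) (b - c) =
      4 * dotp b b + 4 * x ^+ 2 * dotp a a - 8 * x ^+ 2.
    by rewrite c_eq /x !dotpE !mxE; ring.
  by rewrite ui uj; ring.
have tba : dotp b (perp a) = - s by rewrite /s !dotp_perpE; ring.
have tac : dotp a (perp c) = - s by rewrite /s c_eq !dotp_perpE !mxE; ring.
have tbc : dotp b (perp c) = - (2 * x * s).
  by rewrite /s /x c_eq !dotp_perpE !mxE; ring.
rewrite dab in rij; rewrite dbc in rjk.
rewrite dab dac tac -/s in bal_i; rewrite dba dbc tba tbc in bal_j.
(* [4 * s ^ 2] is the squared distance between the mirror images. *)
have s0 : s != 0.
  by apply: contraNneq rjk => s0; apply/eqP; move: s2; rewrite s0; lra.
apply/eqP; rewrite -subr_eq0; apply/negPn/negP => m23.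
have x_half : x = 2^-1.
  have /eqP : (m2 - m3) * s * ((2 - 2 * x)^-1 - 1) = 0 by rewrite -bal_i; ring.
  rewrite !mulf_eq0 (negbTE m23) (negbTE s0) /= subr_eq0 => /eqP inv1.
  by move: (mulfV rij); rewrite inv1; lra.
have d3 : 4 - 4 * x ^+ 2 = 3 by rewrite x_half; field.
have d1 : 2 - 2 * x = 1 by rewrite x_half; field.
move: bal_j; rewrite d1 d3 invr1 subrr mulr0 mul0r add0r x_half => /eqP.
rewrite mulf_eq0 mulf_eq0 (negbTE m3_neq0) oppr_eq0 mulf_eq0 (negbTE s0) /= orbF.
by apply/negP; lra.
Qed.

Theorem theorem8 (R : realType) (mu : 'I_3 -> R) (qbar : 'I_4 -> 'rV[R]_2)
    (hmu : forall i, mu i != 0)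
    (heq : rel_equilibrium_1n mu qbar)
    (hsym : symmetric_configuration qbar) :
  exists i j : 'I_3, i != j /\ mu i = mu j.
Proof.
case: hsym => p [d [i [j [k [_ uijk l0 li ck]]]]].
have [ij ik jk] : [/\ i != j, i != k & j != k].
  by move: uijk; rewrite /= !inE !negb_or andbT => /andP[/andP[]].
exists j, k; split=> //.
have ujik : uniq [:: j; i; k] by rewrite /= !inE !negb_or eq_sym ij jk ik.
have /= bal_i := limit_torque_balance i heq; rewrite (sum_ord3_neq _ uijk) in bal_i.
have /= bal_j := limit_torque_balance j heq; rewrite (sum_ord3_neq _ ujik) in bal_j.
rewrite (limit_strong_vortex heq) in l0.
rewrite (mirror_through_origin _ l0 li (limit_unit_circle i heq)) in ck.
apply: (symmetric_balance_weights _ _ ck _ _ bal_i bal_j (hmu k)).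
- exact: limit_unit_circle heq.
- exact: limit_unit_circle heq.
- by apply: limit_noncollision heq _; rewrite (inj_eq (@lift_inj _ _)).
- by apply: limit_noncollision heq _; rewrite (inj_eq (@lift_inj _ _)).
Qed.
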